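(* Let $\tilde F(q,g)$ be the approximate evidence lower bound of the mean-field empirical Bayes generalized linear model (defined in the context), where $q=\prod_{j=1}^p q_j$ ranges over product distributions on $\mathbb{R}^p$ and $g$ ranges over the prior family $\mathcal{G}$. For $\boldsymbol\theta=(\theta_1,\dots,\theta_p)\in\mathbb{R}^p$, $g\in\mathcal{G}$ and $j=1,\dots,p$, define $$r_j(\boldsymbol\theta,g)=\min_{q_j:\ \mathbb{E}_{q_j}(\beta_j)=\theta_j}\left(\frac{1}{2s_j^2(\boldsymbol\theta)}V_{q_j}+D_{KL}(q_j\,\|\,g)\right),$$ where $V_{q_j}$ is the variance of $\beta_j$ under $q_j$ and $$s_j^2(\boldsymbol\theta)=\frac{a(\phi)}{\sum_{i=1}^n b''(\boldsymbol x_i^T\boldsymbol\theta)\,x_{ij}^2}.$$ Then $$\max_{q,\,g}\tilde F(q,g)=-\min_{\boldsymbol\theta,\,g}h(\boldsymbol\theta,g),$$ where $$h(\boldsymbol\theta,g)=-\sum_{i=1}^n l_i(\boldsymbol x_i^T\boldsymbol\theta)+\sum_{j=1}^p r_j(\boldsymbol\theta,g).$$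
   Context: Model. Data $(\boldsymbol x_i,y_i)$, $i=1,\dots,n$, with $\boldsymbol x_i=(x_{i1},\dots,x_{ip})^T\in\mathbb{R}^p$ and $y_i\in\mathbb{R}$, are given. The likelihood is a canonical generalized linear model $$p(y_i\mid\boldsymbol\beta)=\exp\left(\frac{y_i\eta_i-b(\eta_i)}{a(\phi)}+c(y_i,\phi)\right),\qquad \eta_i=\boldsymbol x_i^T\boldsymbol\beta,$$ with known dispersion $\phi$ and $a(\phi)>0$; $b$ is the (twice differentiable, convex) log-partition function, and $\sum_i b''(\boldsymbol x_i^T\boldsymbol\theta)x_{ij}^2>0$ for all $j$ and $\boldsymbol\theta$, so that $s_j^2(\boldsymbol\theta)$ is a well-defined positive number. The coefficients have prior $\beta_j\overset{\text{i.i.d.}}{\sim}g$, with $g\in\mathcal{G}$, where $\mathcal{G}$ is an arbitrary (nonempty) family of probability distributions on $\mathbb{R}$. Log-likelihood term. For each $i$ put $l_i(\eta)=(y_i\eta-b(\eta))/a(\phi)$ (the log-likelihood up to an additive constant). Variational family. $q(\boldsymbol\beta)=\prod_{j=1}^p q_j(\beta_j)$, where each $q_j$ is an arbitrary probability distribution on $\mathbb{R}$ (with finite second moment). Write $\bar{\boldsymbol\beta}_q=\mathbb{E}_q(\boldsymbol\beta)$ and $\bar\eta_i=\boldsymbol x_i^T\bar{\boldsymbol\beta}_q$. Approximate evidence lower bound. Let $$\tilde l_i(\eta_i)=l_i(\bar\eta_i)+l_i'(\bar\eta_i)(\eta_i-\bar\eta_i)+\tfrac12 l_i''(\bar\eta_i)(\eta_i-\bar\eta_i)^2,$$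 the second-order Taylor expansion of $l_i$ around $\bar\eta_i$ (which depends on $q$). Then $$\tilde F(q,g)=\mathbb{E}_q\sum_{i=1}^n\tilde l_i(\boldsymbol x_i^T\boldsymbol\beta)-\sum_{j=1}^p D_{KL}(q_j\,\|\,g),$$ where $D_{KL}$ is the Kullback–Leibler divergence, equal to $+\infty$ when $q_j$ is not absolutely continuous with respect to $g$. Convention. $\max$ and $\min$ denote optimal values in the extended reals (supremum and infimum); the minimum over an empty set is $+\infty$. *)

(* Defs.v *)
From HB Require Import structures.
From mathcomp Require Import all_boot all_order all_algebra.
From mathcomp Require Import all_classical all_reals all_analysis.

Set Implicit Arguments.
Unset Strict Implicit.
Unset Printing Implicit Defensive.

Import Order.TTheory GRing.Theory Num.Theory.
Import numFieldNormedType.Exports.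

Local Open Scope classical_set_scope.
Local Open Scope ring_scope.
Local Open Scope charge_scope.

Section distributions.
Context {R : realType}.

(* When q `<< g the negative part of the integrand has a finite integral, so the
   integral is well defined (possibly +oo). *)
Definition KL (q g : probability R R) : \bar R :=
  if `[< q `<< g >]
  then (\int[q]_t (ln (fine (('d (charge_of_finite_measure q) '/d g) t)))%:E)%E
  else +oo%E.

Definition finite_second_moment (q : probability R R) : Prop :=
  ('E_q[fun t : R => (t ^+ 2)%R] < +oo)%E.

(* q is the product measure of the qs j, that is, the coordinates are
   independent under q and the j-th one has distribution qs j. *)
Definition product_distribution p (q : probability (p.-tuple R) R)
    (qs : 'I_p -> probability R R) : Prop :=
  forall A : 'I_p -> set R, (forall j, measurable (A j)) ->
    q [set beta | forall j, A j (tnth beta j)] = (\prod_(j < p) qs j (A j))%E.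

Definition mean_vector p (q : probability (p.-tuple R) R) : p.-tuple R :=
  [tuple fine ('E_q[fun beta => tnth beta j])%E | j < p].

End distributions.

Section glm.
Context {R : realType} {n p : nat}.
(* Design matrix with rows x_i^T, responses y_i, dispersion function a,
   dispersion phi, log-partition function b. *)
Variables (x : 'M[R]_(n, p)) (y : 'I_n -> R) (a : R -> R) (phi : R) (b : R -> R).

Definition lin_pred (i : 'I_n) (beta : p.-tuple R) : R :=
  \sum_(j < p) x i j * tnth beta j.

Definition loglik (i : 'I_n) (eta : R) : R := (y i * eta - b eta) / a phi.

(* Second-order Taylor expansion of loglik i around eta0. *)
Definition loglik2 (i : 'I_n) (eta0 eta : R) : R :=
  loglik i eta0 + (loglik i)^`()%classic eta0 * (eta - eta0)
  + 2^-1 * (loglik i)^`(2)%classic eta0 * (eta - eta0) ^+ 2.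

(* Meaningful when product_distribution q qs holds. *)
Definition approx_elbo (q : probability (p.-tuple R) R)
    (qs : 'I_p -> probability R R) (g : probability R R) : \bar R :=
  ('E_q[fun beta =>
      (\sum_(i < n) loglik2 i (lin_pred i (mean_vector q)) (lin_pred i beta))%R]
   - \sum_(j < p) KL (qs j) g)%E.

Definition s2 (theta : p.-tuple R) (j : 'I_p) : R :=
  a phi / (\sum_(i < n) b^`(2)%classic (lin_pred i theta) * x i j ^+ 2).

Definition penalty (theta : p.-tuple R) (g : probability R R) (j : 'I_p) : \bar R :=
  ereal_inf [set ((1 / (2 * s2 theta j))%:E * 'V_qj[fun t : R => t] + KL qj g)%E
    | qj in [set qj : probability R R | finite_second_moment qj
                /\ ('E_qj[fun t : R => t] = (tnth theta j)%:E)%E]].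

Definition objective (theta : p.-tuple R) (g : probability R R) : \bar R :=
  (- (\sum_(i < n) loglik i (lin_pred i theta))%:E
   + \sum_(j < p) penalty theta g j)%E.

End glm.

(* Main.v *)
(** Fix a product law [q] with mean vector [theta].  In the expectation of the
    second-order expansion the linear terms vanish because the deviations
    [beta_j - theta_j] are centered, and the off-diagonal quadratic terms vanish
    because they are uncorrelated; what is left of the quadratic part is
    [- \sum_j V_j / (2 * s_j^2(theta))].  Hence the approximate evidence lower
    bound is the opposite of the objective in which each penalty is replaced by
    the cost of the factor [q_j] that it minimizes.  Grouping product laws by
    their mean vector, the factors can be optimized separately: any family of
    factors is realized by a product law, and an infimum of sums of costs over
    independent choices is the sum of the infima, costs being bounded below. *)

Require Import Defs.
From HB Require Import structures.
From mathcomp Require Import all_boot all_order all_algebra.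
From mathcomp Require Import all_classical all_reals all_analysis.
From mathcomp Require Import measurable_realfun ring.

Set Implicit Arguments.
Unset Strict Implicit.
Unset Printing Implicit Defensive.

Import Order.TTheory GRing.Theory Num.Theory.
Import numFieldNormedType.Exports.

Local Open Scope classical_set_scope.
Local Open Scope ring_scope.

(** * Lower bound on the Kullback-Leibler divergence *)

(* Also at [u = 0], where both sides are [0]. *)
Lemma ln_geNV (R : realType) (u : R) : 0 <= u -> - u^-1 <= ln u.
Proof.
rewrite le_eqVlt => /predU1P[<-|u0]; first by rewrite invr0 oppr0 ln0.
rewrite lerNl -lnV ?posrE//.
have /(@le_ln1Dx R) : -1 < u^-1 - 1 by rewrite ltrBrDl subrr invr_gt0.
by rewrite addrC subrK => /le_trans; apply; rewrite gerBl.
Qed.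

(* With [h] the density of [q], the negative part of [ln h] is at most [1 / h],
   and [\int[q] 1 / h = g [set t | h t != 0] <= 1]. *)
Lemma KL_geN1 (R : realType) (q g : probability R R) : (-1 <= KL q g)%E.
Proof.
rewrite /KL; case: asboolP => [qg|_]; last by rewrite leey.
set f : R -> \bar R := Radon_Nikodym (charge_of_finite_measure q) g.
pose h : R -> \bar R := Radon_Nikodym_SigmaFinite.f q g.
have mf : measurable_fun [set: R] f.
  by apply: (@measurable_int _ _ _ g); exact: Radon_Nikodym_integrable.
have mh : measurable_fun [set: R] h.
  apply: (@measurable_int _ _ _ g).
  exact: Radon_Nikodym_SigmaFinite.f_integrable.
have h0 t : (0 <= h t)%E by exact: Radon_Nikodym_SigmaFinite.f_ge0.
have hfin t : h t \is a fin_num by exact: Radon_Nikodym_SigmaFinite.f_fin_num.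
have mln (k : R -> \bar R) : measurable_fun [set: R] k ->
    measurable_fun [set: R] (fun t => (ln (fine (k t)))%:E).
  move=> mk; apply/measurable_EFinP; apply: measurableT_comp => //.
  by apply: measurableT_comp.
(* [f] and [h] agree [g]-almost everywhere, hence [q]-almost everywhere by domination; [h] is a
   version that is finite and nonnegative at every point. *)
rewrite (_ : (\int[q]_t _)%E = (\int[q]_t (ln (fine (h t)))%:E)%E); last first.
  apply: ae_eq_integral; [by []|exact: mln|exact: mln|].
  have : ae_eq q setT h f.
    apply: (null_dominates_ae_eq measurableT qg).
    exact: ae_eq_Radon_Nikodym_SigmaFinite.
  by apply: filterS => t /= + tT => ->.
have mhV : measurable_fun [set: R] (EFin \o (fun t => (fine (h t))^-1)).
  have -> : (fun t => (fine (h t))^-1) = (@powR R)^~ (-1) \o (fine \o h).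
    by apply/funext => t /=; rewrite powR_inv1// fine_ge0.
  apply/measurable_EFinP; apply: measurableT_comp; first exact: measurable_powR.
  by apply: measurableT_comp.
have hV0 t : (0 <= ((fine (h t))^-1)%:E)%E by rewrite lee_fin invr_ge0 fine_ge0.
have intV : (\int[q]_t ((fine (h t))^-1)%:E <= 1)%E.
  rewrite -(Radon_Nikodym_SigmaFinite.change_of_variables qg)//.
  rewrite -[leRHS](@probability_setT _ _ _ g) -[leRHS]mul1e -integral_cst//.
  apply: ge0_le_integral => //.
  - by move=> t _; rewrite mule_ge0.
  - exact: emeasurable_funM.
  - move=> t _ /=; rewrite -/(h t) -{2}(fineK (hfin t)) -EFinM lee_fin.
    (* Where the density vanishes the convention [0^-1 = 0] makes the product 0; elsewhere it is
       1. *)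
    by have [->|?] := eqVneq (fine (h t)) 0; rewrite ?mulr0// mulVf.
rewrite integralE -[(-1)%E]add0e leeB//; first exact: integral_ge0.
apply: (le_trans _ intV); apply: ge0_le_integral => //.
  by apply: measurable_funeneg; exact: mln.
move=> t _; rewrite funenegE ge_max hV0 andbT -EFinN lee_fin lerNl.
by rewrite ln_geNV// fine_ge0.
Qed.

(** * Infima of sums over independent choices *)

(** Approaching every infimum within a share of [e] yields one joint choice [u] whose sum exceeds
    the sum of infima by at most [e]. The common bound [M] keeps all infima away from [-oo]. *)
Lemma le_sum_ereal_inf (R : realType) (I : finType) (S : I -> set (\bar R))
    (M : R) (L : \bar R) :
    (forall i v, S i v -> (M%:E <= v)%E) ->
    (forall u, (forall i, S i (u i)) -> (L <= \sum_i u i)%E) ->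
  (L <= \sum_i ereal_inf (S i))%E.
Proof.
move=> SM LS.
have infM i : (M%:E <= ereal_inf (S i))%E by apply: le_ereal_inf_tmp => v /SM.
(* An infimum [+oo], as for an empty [S i], makes the whole sum [+oo] because no term is [-oo]. *)
have [[i Si]|Sfin] := pselect (exists i, ereal_inf (S i) = +oo%E).
  rewrite (_ : (\sum_i _)%E = +oo%E) ?leey//; apply/esum_eqyP.
    by move=> j _; rewrite gt_eqF// (lt_le_trans (ltNyr M)).
  by exists i; rewrite mem_index_enum.
have inf_fin i : ereal_inf (S i) \is a fin_num.
  rewrite fin_numE gt_eqF ?(lt_le_trans (ltNyr M))//=.
  by apply/eqP => Si; apply: Sfin; exists i.
apply/lee_addgt0Pr => e e0.
(* The successor keeps the tolerance positive when [I] is empty. *)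
have e'0 : 0 < e / #|I|.+1%:R by rewrite divr_gt0.
have /choice[u uP] i :
    exists v, S i v /\ (v < ereal_inf (S i) + (e / #|I|.+1%:R)%:E)%E.
  by have [v] := lb_ereal_inf_adherent e'0 (inf_fin i); exists v.
apply: (@le_trans _ _ (\sum_i u i)%E); first by apply: LS => i; have [] := uP i.
apply: (@le_trans _ _ (\sum_i (ereal_inf (S i) + (e / #|I|.+1%:R)%:E))%E).
  by apply: lee_sum => i _; apply/ltW; have [] := uP i.
rewrite big_split/= leeD2l// sumEFin lee_fin sumr_const -[leLHS]mulr_natr.
by rewrite -mulrA ler_piMr// ?(ltW e0)// mulrC ler_pdivrMr// mul1r ler_nat.
Qed.

(** * Existence of product laws *)

Lemma measurable_box (R : realType) p (A : 'I_p -> set R) :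
  (forall j, measurable (A j)) ->
  measurable [set beta : p.-tuple R | forall j, A j (tnth beta j)].
Proof.
move=> mA.
rewrite (_ : mkset _ =
    \bigcap_(j in [set: 'I_p]) ((fun beta : p.-tuple R => tnth beta j) @^-1` A j)).
  apply: fin_bigcap_measurable => // j _.
  rewrite -[X in measurable X]setTI; exact: measurable_tnth.
by apply/seteqP; split=> [beta ? j _ //=|beta H j]; exact: H.
Qed.

(** Induction on [p]: start from the point mass at the empty tuple, then push the product of the
    first factor and the law of the tail forward along cons, under which the preimage of a box is a
    rectangle. *)
Lemma exists_product_distribution (R : realType) p
    (qs : 'I_p -> probability R R) :
  exists q : probability (p.-tuple R) R, product_distribution q qs.
Proof.
elim: p qs => [|p IH] qs.
  exists (\d_ [tuple]) => A _; rewrite big_ord0 [mkset _](_ : _ = setT).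
    by rewrite probability_setT.
  by apply/seteqP; split=> // beta _ [].
have [q' q'E] := IH (fun j => qs (lift ord0 j)).
pose phi (z : R * p.-tuple R) : p.+1.-tuple R := [tuple of z.1 :: z.2].
have mphi : measurable_fun setT phi by apply: measurable_cons.
pose phiM : {mfun (R * p.-tuple R)%type >-> p.+1.-tuple R} :=
  HB.pack phi (isMeasurableFun.Build _ _ _ _ phi mphi).
exists (distribution (qs ord0 \x q')%E phiM) => A mA.
rewrite /distribution /pushforward /=.
pose B := [set beta : p.-tuple R | forall j, A (lift ord0 j) (tnth beta j)].
rewrite (_ : _ @^-1` _ = A ord0 `*` B); last first.
  apply/seteqP; split=> -[t beta] /=.
    move=> H; split; first exact: (H ord0).
    by move=> j; have := H (lift ord0 j); rewrite tnthS.
  move=> [At Bb] j; case: (unliftP ord0 j) => [k ->|->//].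
  by rewrite tnthS.
rewrite product_measure1E//; last first.
  apply: (@measurable_box R p (fun j => A (lift ord0 j))) => j; exact: mA.
rewrite big_ord_recl; congr (_ * _)%E.
by apply: (q'E (fun j => A (lift ord0 j))) => j; exact: mA.
Qed.

(** * Integrability and moments under a product law *)

Lemma Lfun2_of_expectation_sqr d (T : measurableType d) (R : realType)
    (P : probability T R) (X : T -> R) :
  measurable_fun setT X -> ('E_P[(fun t => X t ^+ 2)%R] < +oo)%E ->
  X \in Lfun P 2%:E.
Proof.
rewrite unlock => mX X2; rewrite inE; apply/andP; split; rewrite inE//=.
rewrite /finite_norm unlock /Lnorm; apply: poweR_lty.
under eq_integral do rewrite /= powR_mulrn// real_normK ?num_real//.
by [].
Qed.

(** Integrability is returned along with the expectation so that the result can be nested for double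
    sums. *)
Lemma Lfun1_sum_expectation d (T : measurableType d) (R : realType)
    (P : probability T R) (I : finType) (X : I -> T -> R) :
  (forall i, X i \in Lfun P 1) ->
  (fun t => \sum_i X i t) \in Lfun P 1 /\
  'E_P[(fun t => \sum_i X i t)%R]%E = (\sum_i 'E_P[X i])%E.
Proof.
move=> X1.
have -> : (fun t => \sum_i X i t) = \sum_(Y <- map X (enum I)) Y.
  by apply/funext => t; rewrite big_map big_enum fct_sumE.
split.
  rewrite big_map; apply: rpred_sum => i _; exact: X1.
rewrite expectation_sum; first by rewrite big_map big_enum.
by move=> Y /mapP[i _ ->].
Qed.

Section product_distribution_moments.
Context (R : realType) (p : nat) (q : probability (p.-tuple R) R)
  (qs : 'I_p -> probability R R).
Hypothesis q_qs : product_distribution q qs.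

Let X j (beta : p.-tuple R) : R := tnth beta j.

Let measurable_X j : measurable_fun setT (X j).
Proof. exact: measurable_tnth. Qed.

(** Take the box whose sides are the whole line, of mass 1, except at [j] and [k]. *)
Lemma product_distribution_pair j k (A B : set R) : j != k ->
    measurable A -> measurable B ->
  q [set beta | A (tnth beta j) /\ B (tnth beta k)] = (qs j A * qs k B)%E.
Proof.
move=> jk mA mB.
pose C i := if i == j then A else if i == k then B else setT.
have mC i : measurable (C i) by rewrite /C; do 2![case: ifP => _ //].
have := q_qs mC; rewrite (bigD1 j)//= (bigD1 k) 1?eq_sym//= big1 => [|i]; last first.
  by move=> /andP[/negPf ij /negPf ik]; rewrite /C ij ik probability_setT.
rewrite mule1 /C eqxx eq_sym (negPf jk) eqxx => <-; congr (q _).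
apply/seteqP; split=> beta /=.
  by move=> [Aj Bk] i; case: eqP => [->//|_]; case: eqP => [->|].
move=> H; split; first by have := H j; rewrite eqxx.
by have := H k; rewrite eq_sym (negPf jk) eqxx.
Qed.

Lemma product_distribution_marginal j (A : set R) : measurable A ->
  q [set beta | A (tnth beta j)] = qs j A.
Proof.
move=> mA; pose C i := if i == j then A else setT.
have mC i : measurable (C i) by rewrite /C; case: ifP.
have := q_qs mC; rewrite (bigD1 j)//= big1 => [|i]; last first.
  by move=> /negPf ij; rewrite /C ij probability_setT.
rewrite mule1 /C eqxx => <-; congr (q _).
apply/seteqP; split=> beta /=; first by move=> Aj i; case: eqP => [->|].
by move=> /(_ j); rewrite eqxx.
Qed.

(** Change of variables is applied to the positive and negative parts separately, so infinite values
    are covered; this transfers finiteness of second moments from [qs j] to [q]. *)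
Lemma product_distribution_expectation j (f : R -> R) :
    measurable_fun setT f ->
  'E_q[fun beta => f (tnth beta j)]%E = 'E_(qs j)[f]%E.
Proof.
move=> mf; rewrite unlock integralE [RHS]integralE.
have H (h : R -> \bar R) : measurable_fun setT h -> (forall t, 0 <= h t)%E ->
    (\int[q]_beta h (X j beta) = \int[qs j]_t h t)%E.
  move=> mh h0.
    have := ge0_integral_pushforward (measurable_X j) q measurableT mh
      (fun y _ => h0 y).
    rewrite preimage_setT => <-.
  by apply: eq_measure_integral => A mA _; exact: product_distribution_marginal.
have mfE : measurable_fun setT (EFin \o f) by exact/measurable_EFinP.
congr (_ - _)%E.
  rewrite -(H (EFin \o f)^\+%E)//; last exact: measurable_funepos.
  by apply: eq_integral => beta _; rewrite !funeposE.
rewrite -(H (EFin \o f)^\-%E)//; last exact: measurable_funeneg.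
by apply: eq_integral => beta _; rewrite !funenegE.
Qed.

Hypothesis qs2 : forall j, finite_second_moment (qs j).

Let qs_Lfun2 j : (fun t : R => t) \in Lfun (qs j) 2%:E.
Proof. by apply: Lfun2_of_expectation_sqr; [exact: measurable_id|exact: qs2]. Qed.

Lemma product_distribution_Lfun2 j :
  (fun beta : p.-tuple R => tnth beta j) \in Lfun q 2%:E.
Proof.
apply: Lfun2_of_expectation_sqr; first exact: measurable_X.
rewrite (product_distribution_expectation j (f := fun t => t ^+ 2)).
  exact: qs2.
exact: measurable_funX.
Qed.

(** The joint law of two coordinates agrees with the product measure on rectangles, hence
    everywhere, and Fubini factors the integral. *)
Lemma product_distribution_expectationM j k : j != k ->
  'E_q[(fun beta => tnth beta j * tnth beta k)%R]%E
  = ('E_(qs j)[fun t : R => t] * 'E_(qs k)[fun t : R => t])%E.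
Proof.
move=> jk.
pose phi beta : (R * R)%type := (X j beta, X k beta).
have mphi : measurable_fun setT phi by apply: measurable_fun_pair.
pose f (z : R * R) : \bar R := (z.1 * z.2)%:E.
have mf : measurable_fun setT f.
  by apply/measurable_EFinP; apply: measurable_funM.
(* The integrability that Fubini requires is proved under [q], as a product of two square-integrable
   functions, and then pushed forward. *)
have intq : q.-integrable setT (f \o phi).
  apply/Lfun1_integrable.
  exact: Lfun2_mul_Lfun1 (product_distribution_Lfun2 j)
    (product_distribution_Lfun2 k).
have push (h : R * R -> \bar R) :
    (\int[pushforward q phi]_z h z = \int[(qs j \x qs k)]_z h z)%E.
  apply: eq_measure_integral => A mA _; apply/esym.
  pose pq := distribution q (mfun_Sub (mem_set mphi)).
  apply: (@product_measure_unique _ _ _ _ _ _ _ pq) => // B C mB mC.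
  exact: product_distribution_pair.
have intprod : (qs j \x qs k)%E.-integrable setT f.
  have /integrableP[_ fI] := integrable_pushforward mphi mf intq measurableT.
  by apply/integrableP; split => //; rewrite -push.
have id_int i : (qs i).-integrable setT (EFin \o (fun t : R => t)).
  by apply/Lfun1_integrable; apply: Lfun_subset12 => //; exact: fin_num_measure.
transitivity (\int[q]_beta (f \o phi) beta)%E; first by rewrite unlock.
have := integral_pushforward mphi mf intq measurableT.
rewrite preimage_setT => <-; rewrite push.
rewrite -integral12_prod_meas1// /fubini_F /f/=.
under eq_integral do under eq_integral do rewrite EFinM.
under eq_integral => t _.
  rewrite integralZl//; last exact: id_int.
  rewrite -(fineK (integrable_fin_num _ (id_int k)))//.
  over.
rewrite integralZr//; last exact: id_int.
by rewrite fineK ?unlock//; exact: (integrable_fin_num _ (id_int k)).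
Qed.

Local Notation m j := (tnth (mean_vector q) j).

Lemma expectation_tnth_fin j :
  ('E_q[fun beta => tnth beta j] = (m j)%:E)%E.
Proof.
rewrite tnth_mktuple fineK//; apply: expectation_fin_num; apply: Lfun_subset12.
  exact: fin_num_measure.
exact: product_distribution_Lfun2.
Qed.

(** The diagonal case depends on one marginal only, whose mean is [m j]; off the diagonal the
    expectation is a covariance, which vanishes since the expectation of the product factors. *)
Lemma product_distribution_centeredM j k :
  (fun beta => (tnth beta j - m j) * (tnth beta k - m k)) \in Lfun q 1 /\
  'E_q[(fun beta => (tnth beta j - m j) * (tnth beta k - m k))%R]%E
  = (if j == k then 'V_(qs j)[fun t : R => t]%E else 0%E).
Proof.
have L2 i : (fun beta => tnth beta i - m i) \in Lfun q 2%:E.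
  have -> : (fun beta => tnth beta i - m i) = X i \- cst (m i) by [].
  rewrite rpredB ?lee1n// => ?; [exact: product_distribution_Lfun2|].
  exact: Lfun_cst.
split; first exact: Lfun2_mul_Lfun1 (L2 j) (L2 k).
have [<-|jk] := eqVneq j k.
  rewrite /variance [in RHS]unlock.
  have mE : fine 'E_(qs j)[fun t : R => t]%E = m j.
    by rewrite tnth_mktuple (product_distribution_expectation j (f := fun t => t)).
  rewrite mE (product_distribution_expectation j
    (f := fun t => (t - m j) * (t - m j)))//.
  by apply: measurable_funM; apply: measurable_funB.
have -> : 'E_q[(fun beta => (tnth beta j - m j) * (tnth beta k - m k))%R]%E
    = covariance q (X j) (X k) by rewrite [in RHS]unlock !tnth_mktuple.
have X2 i : X i \in Lfun q 2%:E by exact: product_distribution_Lfun2.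
have X1 i : X i \in Lfun q 1 
  by apply: Lfun_subset12 => //; exact: fin_num_measure.
rewrite covarianceE//; last exact: Lfun2_mul_Lfun1.
rewrite product_distribution_expectationM//.
rewrite -!(product_distribution_expectation _ (f := fun t => t))//.
by rewrite !expectation_tnth_fin -EFinM subee.
Qed.

(** Stated for abstract coefficients, to be instantiated with the value, gradient and half Hessian
    of the log-likelihood at the mean vector. *)
Lemma expectation_quadratic (C : R) (c : 'I_p -> R) (e : 'I_p -> 'I_p -> R) :
  'E_q[(fun beta => C + \sum_j c j * (tnth beta j - m j)
     + \sum_j \sum_k e j k * ((tnth beta j - m j) * (tnth beta k - m k)))%R]%E
  = (C + \sum_j e j j * fine 'V_(qs j)[fun t : R => t]%E)%:E.
Proof.
have X1 j : X j \in Lfun q 1.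
  apply: Lfun_subset12; first exact: fin_num_measure.
  exact: product_distribution_Lfun2.
have scale a (f : p.-tuple R -> R) : f \in Lfun q 1 ->
    (fun beta => a * f beta) \in Lfun q 1 /\
    'E_q[(fun beta => a * f beta)%R]%E = (a%:E * 'E_q[f])%E.
  move=> f1; have -> : (fun beta => a * f beta) = a \o* f.
    by apply/funext => beta /=; rewrite mulrC.
  by split; [exact: Lfun_scale|exact: expectationZl].
have L1 j : (fun beta => tnth beta j - m j) \in Lfun q 1.
  have -> : (fun beta => tnth beta j - m j) = X j \- cst (m j) by [].
  by rewrite rpredB ?Lfun_cst.
have E1 j : 'E_q[(fun beta => tnth beta j - m j)%R]%E = 0%E.
  have -> : (fun beta => tnth beta j - m j) = X j \- cst (m j) by [].
  by rewrite expectationB ?Lfun_cst// expectation_cst expectation_tnth_fin subee.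
have [S1 SE] := Lfun1_sum_expectation (fun j => (scale (c j) _ (L1 j)).1).
have M1 j k := (product_distribution_centeredM j k).1.
have [T1 TE] := Lfun1_sum_expectation (fun j =>
  (Lfun1_sum_expectation (fun k => (scale (e j k) _ (M1 j k)).1)).1).
set S := (fun beta => \sum_j c j * _) in S1 SE.
set D := (fun beta => \sum_j \sum_k _) in T1 TE.
rewrite -[X in expectation q X]/((cst C \+ S) \+ D).
have C1 : cst C \in Lfun q 1 by exact: Lfun_cst.
have CS1 : (cst C \+ S)%R \in Lfun q 1 by rewrite rpredD.
rewrite (expectationD CS1 T1) (expectationD C1 S1) expectation_cst SE TE.
rewrite big1 ?adde0 => [|j _]; last by rewrite (scale _ _ (L1 j)).2 E1 mule0.
rewrite EFinD -sumEFin; congr (_ + _)%E; apply: eq_bigr => j _.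
rewrite (Lfun1_sum_expectation (fun k => (scale (e j k) _ (M1 j k)).1)).2.
rewrite (bigD1 j)//= big1 => [|k kj]; last first.
  rewrite (scale _ _ (M1 j k)).2 (product_distribution_centeredM j k).2.
  by rewrite eq_sym (negPf kj) mule0.
rewrite adde0 (scale _ _ (M1 j j)).2 (product_distribution_centeredM j j).2.
by rewrite eqxx EFinM fineK//; exact: variance_fin_num (qs_Lfun2 j).
Qed.

End product_distribution_moments.

(** * Second-order expansion of the log-likelihood *)

Lemma derive1_subr_divr (R : realType) (u f : R -> R) (k t : R) :
    derivable u t 1 -> derivable f t 1 ->
  (fun s => (u s - f s) / k)^`()%classic t
  = (u^`()%classic t - f^`()%classic t) / k.
Proof.
move=> du df.
have -> : (fun s => (u s - f s) / k) = k^-1 \*: (u - f).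
  by apply/funext => s /=; rewrite mulrC.
have dE := deriveB du df.
rewrite derive1E deriveZ; last exact: derivableB du df.
by rewrite dE !derive1E [LHS]mulrC.
Qed.

Section glm.
Context (R : realType) (n p : nat) (x : 'M[R]_(n, p)) (y : 'I_n -> R)
  (a : R -> R) (phi : R) (b : R -> R).
Hypothesis b_derivable : forall t, derivable b t 1.
Hypothesis b_derivable2 : forall t, derivable b^`()%classic t 1.

Lemma loglik_derive2 i t :
  (loglik y a phi b i)^`(2)%classic t = - b^`(2)%classic t / a phi.
Proof.
(* Writing [y i] as [cst (y i) t] gives the first derivative the shape of [derive1_subr_divr], which
   then applies a second time. *)
have D1 : (loglik y a phi b i)^`()%classic
    = fun t => (cst (y i) t - b^`()%classic t) / a phi.
  apply/funext => s.
  have dlin : is_derive s (1 : R) (y i \*: @id R^o) (y i).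
    by apply: is_derive_eq; rewrite /GRing.scale/= mulr1.
  rewrite (derive1_subr_divr (u := y i \*: @id R^o))//.
  by rewrite derive1E derive_val.
rewrite !derive1nS !derive1n0 D1 derive1_subr_divr//.
by rewrite derive1_cst add0r.
Qed.

Lemma lin_predB i (beta theta : p.-tuple R) :
  lin_pred x i beta - lin_pred x i theta
  = \sum_(j < p) x i j * (tnth beta j - tnth theta j).
Proof. by rewrite -sumrB; apply: eq_bigr => j _; rewrite mulrBr. Qed.

(** Expanding the squared predictor deviations and exchanging sums gives the form that
    [expectation_quadratic] takes. *)
Lemma sum_loglik2E (theta beta : p.-tuple R) :
  let l i := loglik y a phi b i in
  let eta i := lin_pred x i theta in
  let Z j := tnth beta j - tnth theta j in
  \sum_(i < n) loglik2 y a phi b i (eta i) (lin_pred x i beta)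
  = \sum_(i < n) l i (eta i)
    + \sum_(j < p) (\sum_(i < n) (l i)^`()%classic (eta i) * x i j) * Z j
    + \sum_(j < p) \sum_(k < p)
        (\sum_(i < n) 2^-1 * (l i)^`(2)%classic (eta i) * (x i j * x i k))
        * (Z j * Z k).
Proof.
move=> l eta Z.
under eq_bigr do rewrite /loglik2 lin_predB.
rewrite !big_split/=; congr (_ + _ + _).
  under [RHS]eq_bigr do rewrite big_distrl/=.
  rewrite exchange_big/=; apply: eq_bigr => i _.
  by rewrite big_distrr/=; apply: eq_bigr => j _; rewrite mulrA.
under [RHS]eq_bigr => j _.
  under eq_bigr do rewrite big_distrl/=.
  rewrite exchange_big/=.
  over.
rewrite exchange_big/=; apply: eq_bigr => i _.
rewrite expr2 big_distrl big_distrr/=; apply: eq_bigr => j _.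
rewrite !big_distrr/=; apply: eq_bigr => k _.
rewrite -/(Z j) -/(Z k). by ring.
Qed.

(** The diagonal coefficient of the quadratic form in [sum_loglik2E], which multiplies the [j]-th
    variance in the expectation. *)
Let curvature theta j :=
  \sum_(i < n) 2^-1 * (loglik y a phi b i)^`(2)%classic (lin_pred x i theta)
    * (x i j * x i j).

Lemma curvatureE theta j : curvature theta j = - (1 / (2 * s2 x a phi b theta j)).
Proof.
rewrite /s2 div1r invfM invf_div mulrC big_distrl big_distrl -sumrN/=.
by apply: eq_bigr => i _; rewrite loglik_derive2/=; ring.
Qed.

(** The quantity that [penalty] minimizes, at a given factor [qj]. *)
Definition factor_cost (theta : p.-tuple R) (qj g : probability R R) j : \bar R :=
  ((1 / (2 * s2 x a phi b theta j))%:E * 'V_qj[fun t : R => t] + KL qj g)%E.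

Lemma approx_elboE (q : probability (p.-tuple R) R)
    (qs : 'I_p -> probability R R) (g : probability R R) :
    product_distribution q qs -> (forall j, finite_second_moment (qs j)) ->
  let theta := mean_vector q in
  approx_elbo x y a phi b q qs g
  = (- (- (\sum_(i < n) loglik y a phi b i (lin_pred x i theta))%:E
        + \sum_(j < p) factor_cost theta (qs j) g j))%E.
Proof.
move=> q_qs qs2 theta; rewrite /approx_elbo -/theta.
have V_fin j : 'V_(qs j)[fun t : R => t]%E \is a fin_num.
  apply: variance_fin_num; apply: Lfun2_of_expectation_sqr; last exact: qs2.
  exact: measurable_id.
under [X in expectation q X]eq_fun do rewrite sum_loglik2E.
rewrite (expectation_quadratic q_qs qs2).
under [X in (_ + X)%:E]eq_bigr do rewrite -/(curvature _ _) curvatureE.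
have -> : (\sum_(j < p) factor_cost theta (qs j) g j
    = (\sum_(j < p) 1 / (2 * s2 x a phi b theta j)
         * fine 'V_(qs j)[fun t : R => t])%:E + \sum_(j < p) KL (qs j) g)%E.
  rewrite big_split/= -sumEFin; congr (_ + _)%E; apply: eq_bigr => j _.
  by rewrite [RHS]EFinM fineK.
(* The likelihood and variance terms form one real number, so the opposite distributes over the sum
   even if a divergence is [+oo]. *)
rewrite addeA -EFinN -EFinD [in RHS]addeC fin_num_oppeD// [in RHS]addeC.
rewrite -EFinN opprD opprK -sumrN.
by congr (_%:E - _)%E; congr (_ + _); apply: eq_bigr => j _; rewrite mulNr.
Qed.

End glm.

(** * Optimization over product laws grouped by mean vector *)

Theorem lemma2p1 (R : realType) (n p : nat) (x : 'M[R]_(n, p)) (y : 'I_n -> R)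
    (a : R -> R) (phi : R) (b : R -> R) (G : set (probability R R))
    (a_gt0 : 0 < a phi)
    (b_derivable : forall t, derivable b t 1)
    (b_derivable2 : forall t, derivable b^`()%classic t 1)
    (b_convex : convex_function (E := R^o) setT b)
    (curvature_gt0 : forall (theta : p.-tuple R) (j : 'I_p),
      0 < \sum_(i < n) b^`(2)%classic (lin_pred x i theta) * x i j ^+ 2)
    (G_nonempty : G !=set0) :
  ereal_sup [set v | exists (q : probability (p.-tuple R) R)
                            (qs : 'I_p -> probability R R) (g : probability R R),
    [/\ product_distribution q qs, (forall j, finite_second_moment (qs j)),
        G g & v = approx_elbo x y a phi b q qs g]]
  = (- ereal_inf [set objective x y a phi b theta g
       | theta in [set: p.-tuple R] & g in G])%E.
Proof.
apply/eqP; rewrite eq_le; apply/andP; split.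
  (* Compare [q] with the objective at its own mean vector, where each factor competes in the
     infimum defining its penalty. *)
  apply: ge_ereal_sup => _ [q [qs [g [q_qs qs2 Gg ->]]]].
  rewrite (approx_elboE x y a phi b_derivable b_derivable2 g q_qs qs2) leeN2.
  apply: ge_ereal_inf; exists (objective x y a phi b (mean_vector q) g).
    by exists (mean_vector q) => //; exists g.
  rewrite /objective leeD2l//; apply: lee_sum => j _.
  apply: ereal_inf_lbound; exists (qs j) => //; split; first exact: qs2.
  rewrite tnth_mktuple -(product_distribution_expectation q_qs j (f := fun t : R => t))//.
  by rewrite (expectation_tnth_fin q_qs qs2).
rewrite leeNl; apply: le_ereal_inf_tmp => _ [theta _ [g Gg <-]].
rewrite /objective -leeBlDl//.
(* Costs are at least -1: the variance term is nonnegative as [s2] is positive, and [KL_geN1] bounds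
   the divergence. *)
apply: (le_sum_ereal_inf (M := -1)).
  move=> j _ [qj _ <-]; rewrite -[(_%:E)%E]add0e leeD ?KL_geN1//.
  rewrite mule_ge0 ?variance_ge0// lee_fin divr_ge0// mulr_ge0//.
  by rewrite divr_ge0 ?(ltW a_gt0)// ltW.
move=> u uP.
(* The costs [u] come from factors with means [tnth theta j]; their product law has mean vector
   [theta] and enters the supremum. *)
have /choice[qs qsP] j : exists qj : probability R R,
    [/\ finite_second_moment qj, ('E_qj[fun t : R => t] = (tnth theta j)%:E)%E
      & factor_cost x a phi b theta qj g j = u j].
  by have [qj [? ?] <-] := uP j; exists qj.
have [q q_qs] := exists_product_distribution qs.
have qs2 j : finite_second_moment (qs j) by have [] := qsP j.
have meanE : mean_vector q = theta.
  apply: eq_from_tnth => j; rewrite tnth_mktuple.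
  rewrite (product_distribution_expectation q_qs j (f := fun t : R => t))//.
  by have [_ -> _] := qsP j.
rewrite leeBlDl// leeNl.
apply: le_ereal_sup_tmp; exists (approx_elbo x y a phi b q qs g).
  by exists q, qs, g; split.
rewrite (approx_elboE x y a phi b_derivable b_derivable2 g q_qs qs2) meanE.
rewrite leeN2 leeD2l//; apply: lee_sum => j _.
by have [_ _ ->] := qsP j.
Qed.
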